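(* Let $K \subseteq \mathbb{R}^d$ be a non-degenerate continuum. Then there exists a rectifiable curve $f\colon [a,b] \to \mathbb{R}^d$ such that, with $\Gamma = f([a,b])$, the intersection $\Gamma \cap K$ has Hausdorff dimension $1$, i.e. $\dim_H(\Gamma \cap K) = 1$.
   Context: A continuum is a compact connected topological space (here, a subset of $\mathbb{R}^d$ with the subspace topology); it is non-degenerate if it contains more than one point. A curve is a continuous map $f\colon [a,b] \to \mathbb{R}^d$; its length is $\sup\{\sum_{i=1}^n |f(x_i)-f(x_{i-1})| : n \in \mathbb{N}^+,\ a = x_0 < \dots < x_n = b\}$, and $f$ is rectifiable if its length is finite. The intersection of a curve with a set means the intersection of its image with the set. For $A \subseteq \mathbb{R}^d$ and $s \ge 0$, the $s$-dimensional Hausdorff measure is $\mathcal{H}^s(A) = \lim_{\delta \to 0+} \mathcal{H}^s_\delta(A)$, where $\mathcal{H}^s_\delta(A) = \inf\{\sum_{i=1}^\infty (\operatorname{diam} A_i)^s : A \subseteq \bigcup_{i=1}^\infty A_i,\ \operatorname{diam} A_i \le \delta \text{ for all } i\}$, and the Hausdorff dimension is $\dim_H A = \sup\{s \ge 0 : \mathcal{H}^s(A) > 0\}$. *)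

(* Defs.v *)
From HB Require Import structures.
From mathcomp Require Import all_boot all_order all_algebra.
From mathcomp Require Import all_classical all_reals all_analysis.

Set Implicit Arguments.
Unset Strict Implicit.
Unset Printing Implicit Defensive.

Import Order.TTheory GRing.Theory Num.Theory.
Import numFieldNormedType.Exports.

Local Open Scope classical_set_scope.
Local Open Scope ring_scope.

Definition continuum (T : topologicalType) (K : set T) : Prop :=
  compact K /\ connected K.

Definition non_degenerate (T : Type) (K : set T) : Prop :=
  exists x y, [/\ K x, K y & x <> y].

(* The library norm on ['rV[R]_d] is the sup norm. It induces the same topology
   as the Euclidean norm, so the library's topological notions apply unchanged,
   but lengths and diameters have to be Euclidean. *)
Definition eucl_norm (R : realType) (d : nat) (x : 'rV[R]_d) : R :=
  Num.sqrt (\sum_(i < d) x 0 i ^+ 2).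

(* As for [numfun.variation], a subdivision a = x_0 < ... < x_n = b is given by
   the sequence s = [:: x_1; ...; x_n]; when a < b this forces 1 <= n. *)
Definition polygonal_length (R : realType) (d : nat) (a b : R)
    (f : R -> 'rV[R]_d) (s : seq R) : R :=
  let x := nth b (a :: s) in
  \sum_(0 <= i < size s) eucl_norm (f (x i.+1) - f (x i)).

Definition curve_length (R : realType) (d : nat) (a b : R)
    (f : R -> 'rV[R]_d) : \bar R :=
  ereal_sup [set (polygonal_length a b f s)%:E | s in itv_partition a b].

(* Only the values of [f] on [a, b] matter. *)
Definition curve (R : realType) (d : nat) (a b : R)
    (f : R -> 'rV[R]_d) : Prop :=
  a < b /\ {within `[a, b], continuous f}.

Definition rectifiable (R : realType) (d : nat) (a b : R)
    (f : R -> 'rV[R]_d) : Prop :=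
  (curve_length a b f < +oo)%E.

(* [maxe 0] only serves to give the empty set diameter 0. *)
Definition diam (R : realType) (d : nat) (A : set 'rV[R]_d) : \bar R :=
  maxe 0%E
    (ereal_sup [set (eucl_norm (p.1 - p.2))%:E | p in [set p | A p.1 /\ A p.2]]).

(* The usual convention for s = 0: the empty set contributes 0 and every
   nonempty set contributes 1 (0 `^ 0 = 1). *)
Definition diam_pow (R : realType) (d : nat) (s : R) (A : set 'rV[R]_d)
    : \bar R :=
  if A == set0 then 0%E else (diam A `^ s)%E.

Definition hausdorff_premeasure (R : realType) (d : nat) (s delta : R)
    (A : set 'rV[R]_d) : \bar R :=
  ereal_inf [set (\sum_(0 <= i <oo) diam_pow s (B i))%E
            | B in [set B : nat -> set 'rV[R]_d |
                     A `<=` \bigcup_i B i /\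
                     forall i, (diam (B i) <= delta%:E)%E]].

Definition hausdorff_measure (R : realType) (d : nat) (s : R)
    (A : set 'rV[R]_d) : \bar R :=
  lim (hausdorff_premeasure s delta A @[delta --> 0^'+]).

Definition hausdorff_dim (R : realType) (d : nat) (A : set 'rV[R]_d) : \bar R :=
  ereal_sup [set s%:E | s in [set s : R | 0 <= s /\
                                          (0 < hausdorff_measure s A)%E]].

(* Main.v *)
Require Import Defs.
From HB Require Import structures.
From mathcomp Require Import all_boot all_order all_algebra.
From mathcomp Require Import all_classical all_reals all_analysis.
From mathcomp Require Import ring lra zify.

Set Implicit Arguments.
Unset Strict Implicit.
Unset Printing Implicit Defensive.

Import Order.TTheory GRing.Theory Num.Theory.
Import numFieldNormedType.Exports.

Local Open Scope classical_set_scope.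
Local Open Scope ring_scope.

(** A connected set [K] with two points at distance [D] meets every sphere of
    radius at most [D / 2] centred on [K], since the distance to the centre
    takes all intermediate values on [K] ([connected_meets_sphere]). So every
    point of [K] has around it, at prescribed and equally spaced distances, as
    many points of [K] as one likes. Iterating this choice gives a tree of
    points of [K] ([connected_tree]): a node of level [k] has
    [m_k = 2 ^ (2 k + 1)] children (that is [nchildren k]), all within
    [r_k / 2] of it and at mutual distance at least [3 r_(k+1)], with
    [8 m_k r_(k+1) = r_k]. The level-[k] nodes that matter are
    [P_k = m_0 ... m_(k-1) = 2 ^ (k ^ 2)] in number (that is [ncells k]), so
    they can be indexed by the integer part of [u * P_k] for [u] in [[0, 1)],
    and by compactness each [u] selects a limit point [x u] of [K]
    ([tree_points]).

    Two estimates on [x] compete. If [u] and [v] share their level-[k] cell but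
    not their level-[k+1] cell, then
    [r_(k+1) <= |x u - x v| <= 2 r_k] and [|u - v| <= 1 / P_k].

    - Joining all siblings at all levels costs a length of order
      [\sum_k P_(k+1) r_k], a convergent series because each [r_k] carries a
      factor [8 ^ (- k)] while [P_(k+1) / P_k] is only of order [4 ^ k]. This is
      made precise by a bounded increasing function, [clock], whose jump
      dominates [r_k] as soon as two parameters are separated at level [k+1].
      With respect to it [x] is 2-Lipschitz, hence extends to a Lipschitz curve
      on a compact interval ([lipschitz_extension]). A Lipschitz curve is
      rectifiable, and its image is null for [H^s] for every [s > 1]
      ([hausdorff_measure_lipschitz]).

    - Since [P_k] grows superexponentially with
      [log P_(k+1) / log P_k --> 1], for each [s < 1] one has
      [1 / P_k <= C r_(k+1) ^ s] ([radius_hoelder]), so the inverse of [x] is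
      [s]-Hoelder from the points [x u] onto [[0, 1)]. A Hoelder map onto an
      interval forces positive [H^s] measure, by countable subadditivity of the
      Lebesgue measure ([hausdorff_measure_gt0]).

    The whole construction uses the sup norm; it is compared with the
    Euclidean one only when diameters and lengths enter. *)

(** * Sup norm, Euclidean norm and diameters *)

Lemma coord_le_norm (R : realType) (d : nat) (x : 'rV[R]_d) (i : 'I_d) :
  `|x 0 i| <= `|x|.
Proof.
by rewrite [leRHS]/Num.Def.normr/= mx_normrE; apply/bigmax_geP; right => /=; exists (0, i).
Qed.

Lemma norm_le_coord (R : realType) (d : nat) (x : 'rV[R]_d) (c : R) :
  0 <= c -> (forall i, `|x 0 i| <= c) -> `|x| <= c.
Proof.
move=> c0 xc; rewrite [leLHS]/Num.Def.normr/= mx_normrE.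
by apply: bigmax_le => //= -[j i] _ /=; rewrite (ord1 j).
Qed.

Lemma norm_le_eucl (R : realType) (d : nat) (x : 'rV[R]_d) :
  `|x| <= eucl_norm x.
Proof.
apply: norm_le_coord; first exact: sqrtr_ge0.
move=> i; rewrite -sqrtr_sqr ler_wsqrtr// (bigD1 i)//= lerDl.
by apply: sumr_ge0 => j _; exact: sqr_ge0.
Qed.

Lemma eucl_le_norm (R : realType) (d : nat) (x : 'rV[R]_d) :
  eucl_norm x <= d%:R * `|x|.
Proof.
rewrite -[leRHS]ger0_norm ?mulr_ge0// -sqrtr_sqr ler_wsqrtr//.
apply: (@le_trans _ _ (\sum_(i < d) `|x| ^+ 2)).
  by apply: ler_sum => i _; rewrite -[leLHS]real_normK ?num_real// lerXn2r ?nnegrE// coord_le_norm.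
rewrite sumr_const card_ord exprMn -[leLHS]mulr_natl ler_wpM2r ?sqr_ge0//.
by rewrite -natrX ler_nat -[leqLHS]expn1; case: d {x} => // d; rewrite leq_pexp2l.
Qed.

Section diameter.
Context (R : realType) (d : nat).
Implicit Types A : set 'rV[R]_d.

Lemma diam_ge0 A : (0 <= diam A)%E.
Proof. by rewrite /diam le_max lexx. Qed.

Lemma norm_le_diam A (p q : 'rV[R]_d) :
  A p -> A q -> (`|p - q|%:E <= diam A)%E.
Proof.
move=> Ap Aq; rewrite /diam le_max; apply/orP; right.
apply: (@le_trans _ _ (eucl_norm (p - q))%:E); first by rewrite lee_fin norm_le_eucl.
by apply: ereal_sup_ubound; exists (p, q).
Qed.

Lemma diam_le A (c : R) : 0 <= c ->
  (forall p q, A p -> A q -> `|p - q| <= c) -> (diam A <= (d%:R * c)%:E)%E.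
Proof.
move=> c0 Ac; rewrite /diam ge_max lee_fin mulr_ge0//=.
apply: ge_ereal_sup => _ [[p q] [/= Ap Aq] <-]; rewrite lee_fin.
by rewrite (le_trans (eucl_le_norm _))// ler_wpM2l// Ac.
Qed.

Lemma diam_pow_ge0 (s : R) A : (0 <= diam_pow s A)%E.
Proof. by rewrite /diam_pow; case: ifP => // _; exact: poweR_ge0. Qed.

End diameter.

(** * Bounds on Hausdorff measures *)

Section hausdorff.
Context (R : realType) (d : nat).
Implicit Types A : set 'rV[R]_d.

Lemma hausdorff_premeasure_ge0 (s delta : R) A :
  (0 <= hausdorff_premeasure s delta A)%E.
Proof.
apply: le_ereal_inf_tmp => _ [B _ <-].
by apply: nneseries_ge0 => i _ _; exact: diam_pow_ge0.
Qed.

(** The premeasure grows as [delta] decreases, so that the limit defining the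
    measure exists and inherits any bound common to all scales. *)
Lemma hausdorff_measure_ge (s : R) A (c : \bar R) :
  (forall delta, 0 < delta -> (c <= hausdorff_premeasure s delta A)%E) ->
  (c <= hausdorff_measure s A)%E.
Proof.
move=> cA; apply: lime_ge; last first.
  by near=> e; apply: cA; near: e; exact: nbhs_right_gt.
apply: nonincreasing_at_right_is_cvge; near=> e => y z _ _ yz.
apply: ereal_inf_le_tmp => _ [B [AB Bd] <-]; exists B => //; split=> // i.
by rewrite (le_trans (Bd i))// lee_fin.
Unshelve. all: end_near. Qed.

Lemma hausdorff_measure_eq0 (s : R) A :
  (forall delta e, 0 < delta -> 0 < e ->
    (hausdorff_premeasure s delta A <= e%:E)%E) ->
  hausdorff_measure s A = 0%E.
Proof.
move=> A0; apply/cvg_lim => //; apply: cvg_near_cst.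
near=> delta; apply/eqP; rewrite eq_le hausdorff_premeasure_ge0 andbT.
apply/lee_addgt0Pr => e e0; rewrite add0e A0//.
Unshelve. all: end_near. Qed.

(** A set of diameter at most [l] sits in an interval of length [2 l], centred
    at any of its points; countable subadditivity of the Lebesgue measure
    concludes. The factor 2 is the price for having no endpoints to choose. *)
Lemma unit_interval_cover (J : nat -> set R) (l : nat -> R) :
  `[0, 1[%classic `<=` \bigcup_i J i -> (forall i, 0 <= l i) ->
  (forall i u v, J i u -> J i v -> `|u - v| <= l i) ->
  (1 <= 2%:E * \sum_(0 <= i <oo) (l i)%:E)%E.
Proof.
move=> cov l0 Jl.
have /choice[a aP] : forall i, exists a, forall u, J i u -> a - l i <= u <= a + l i.
  move=> i; have [[a Ja]|Ji] := pselect (exists a, J i a).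
    by exists a => u Ju; rewrite -ler_distl; exact: Jl.
  by exists 0 => u Ju; case: Ji; exists u.
pose F i := `[a i - l i, a i + l i]%classic.
have -> : 1%E = lebesgue_measure (`[0%R, 1%R[%classic : set R).
  by rewrite lebesgue_measure_itv/= lte_fin ltr01 oppr0 adde0.
rewrite -nneseriesZl; last by move=> i _; rewrite lee_fin.
apply: (@le_trans _ _ (\sum_(0 <= i <oo) lebesgue_measure (F i))%E).
  apply: measure_sigma_subadditive => // [i|].
    exact: measurable_itv.
  by apply: (subset_trans cov) => u [i _ Ju]; exists i => //; rewrite /F/= in_itv/= aP.
apply: lee_nneseries => // i _; rewrite lebesgue_measure_itv/=.
by case: ifP => _; rewrite -EFinM lee_fin ?mulr_ge0 ?l0//; lra.
Qed.

(** The condition on [x] says that [x u |-> u] is an [s]-Hoelder map from a part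
    of [A] onto [[0, 1)]: it turns a cover of [A] by sets [B i] into a cover of
    [[0, 1)] by sets of diameter at most [C * diam (B i) ^ s]. This replaces the
    usual mass distribution on a Cantor set. *)
Lemma hausdorff_measure_gt0 (s C : R) (x : R -> 'rV[R]_d) A :
  0 < s -> 0 < C -> x @` `[0, 1[ `<=` A ->
  (forall u v, u \in `[0, 1[ -> v \in `[0, 1[ ->
     `|u - v| <= C * `|x u - x v| `^ s) ->
  (0 < hausdorff_measure s A)%E.
Proof.
move=> s0 C0 xA xC.
apply: (@lt_le_trans _ _ ((2 * C)^-1)%:E).
  by rewrite lte_fin invr_gt0 mulr_gt0.
apply: hausdorff_measure_ge => delta delta0.
apply: le_ereal_inf_tmp => _ [B [AB Bd] <-].
have finB i : diam (B i) \is a fin_num.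
  by rewrite ge0_fin_numE ?diam_ge0// (le_lt_trans (Bd i))// ltry.
have finpow i : diam_pow s (B i) \is a fin_num.
  by rewrite /diam_pow; case: ifP => // _; exact: fin_num_poweR.
pose J i := [set u | B i (x u) /\ u \in `[0, 1[].
have := @unit_interval_cover J (fun i => C * fine (diam_pow s (B i))).
have -> : (\sum_(0 <= i <oo) (C * fine (diam_pow s (B i)))%:E
   = C%:E * \sum_(0 <= i <oo) diam_pow s (B i))%E.
  rewrite -nneseriesZl; last by move=> i _; exact: diam_pow_ge0.
  by apply: eq_eseriesr => i _; rewrite EFinM fineK.
move=> H; rewrite -[leLHS]mule1 lee_pdivrMl ?mulr_gt0//.
rewrite EFinM -muleA; apply: H.
- move=> u /= u01; have [i _ Bi] := AB _ (xA _ (imageP x u01)).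
  by exists i.
- by move=> i; rewrite mulr_ge0 ?(ltW C0)// fine_ge0// diam_pow_ge0.
- move=> i u v [Bu u01] [Bv v01]; rewrite (le_trans (xC _ _ u01 v01))//.
  rewrite ler_wpM2l ?(ltW C0)// /diam_pow ifF; last first.
    by apply/negbTE/set0P; exists (x u).
  rewrite fine_poweR ge0_ler_powR ?(ltW s0) ?nnegrE ?fine_ge0 ?diam_ge0//.
  by rewrite -lee_fin fineK// norm_le_diam.
Qed.

(** Cutting [[0, b]] into [n] equal pieces covers [A] by [n] sets of diameter
    at most [c / n], and [n * (c / n) ^ s] tends to 0 when [s > 1]. *)
Lemma hausdorff_measure_lipschitz (s b L : R) (f : R -> 'rV[R]_d) A :
  1 < s -> 0 <= b -> 0 <= L -> (forall t u, `|f t - f u| <= L * `|t - u|) ->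
  A `<=` f @` `[0, b] -> hausdorff_measure s A = 0%E.
Proof.
move=> s1 b0 L0 fL Af; apply: hausdorff_measure_eq0 => delta e delta0 e0.
(* The summand 1 makes [c] positive, even for a constant curve. *)
pose c := d%:R * (L * b) + 1.
have c0 : 0 < c by rewrite ltr_wpDl// !mulr_ge0.
have [n n0 [nd ne]] : exists2 n : nat, (0 < n)%N & c / n%:R <= delta /\
    n%:R * (c / n%:R) `^ s <= e.
  have s10 : 0 < s - 1 by rewrite subr_gt0.
  (* [n * (c / n) ^ s = c ^ s * (1 / n) ^ (s - 1)]. *)
  have := @powR_cvg0 R _ s10 => /cvgrPdist_lt/(_ _ (divr_gt0 e0 (powR_gt0 s c0))).
  rewrite near_withinE => -[eta /= eta0 etaP].
  pose n := (Num.truncn (Num.max eta^-1 (c / delta))).+1.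
  have := truncnS_gt (Num.max eta^-1 (c / delta)).
  rewrite -/n gt_max => /andP[n1 n2].
  have n0 : 0 < n%:R :> R by rewrite ltr0n.
  exists n => //; split.
    by rewrite ler_pdivrMr// mulrC -ler_pdivrMr// ltW.
  have nV0 : 0 < n%:R^-1 :> R by rewrite invr_gt0.
  have := etaP n%:R^-1; rewrite /= !sub0r !normrN !ger0_norm ?powR_ge0 ?(ltW nV0)//.
  move=> /(_ _ nV0); rewrite invf_plt ?posrE// => /(_ n1).
  rewrite ltr_pdivlMr ?powR_gt0// => /ltW; apply: le_trans.
  rewrite powRM ?(ltW c0) ?(ltW nV0)//.
  rewrite -(@mulr_powRB1 _ n%:R^-1 s) ?(ltW nV0)//; last by rewrite (lt_trans _ s1).
  by rewrite mulrCA mulVKf ?gt_eqF// mulrC.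
have n0' : 0 < n%:R :> R by rewrite ltr0n.
pose B i : set 'rV[R]_d :=
  if (i < n)%N then f @` `[i%:R * (b / n%:R), i.+1%:R * (b / n%:R)] else set0.
have Bd i : (diam (B i) <= (c / n%:R)%:E)%E.
  rewrite /B; case: ifP => _; last first.
    apply: (le_trans (@diam_le _ _ _ 0 _ _)) => //.
    by rewrite mulr0 lee_fin divr_ge0// ltW.
  apply: (@le_trans _ _ (d%:R * (L * (b / n%:R)))%:E).
    apply: diam_le; first by rewrite mulr_ge0// divr_ge0.
    move=> _ _ [t + <-] [u + <-]; rewrite /= !in_itv/= => /andP[t1 t2] /andP[u1 u2].
    rewrite (le_trans (fL _ _))// ler_wpM2l// ler_distl.
    by rewrite -natr1 mulrDl mul1r in t2 u2; apply/andP; split; lra.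
  by rewrite lee_fin !mulrA ler_pM2r ?invr_gt0// /c; lra.
apply: (@le_trans _ _ (\sum_(0 <= i <oo) diam_pow s (B i))%E).
  apply: ereal_inf_lbound; exists B => //; split; last first.
    by move=> i; rewrite (le_trans (Bd i))// lee_fin.
  apply: (subset_trans Af) => _ [t + <-]; rewrite /= in_itv/= => /andP[t0 tb].
  (* The first piece ending after [t] is one that contains it. *)
  have P0 : exists i : nat, t <= i.+1%:R * (b / n%:R).
    by exists n.-1; rewrite prednK// mulrCA divff ?mulr1// gt_eqF.
  have [i ti imin] := ex_minnP P0.
  have ni : (i < n)%N.
    by rewrite -(prednK n0) ltnS imin// prednK// mulrCA divff ?mulr1// gt_eqF.
  exists i => //; rewrite /B ni; exists t => //; rewrite /= in_itv/= ti andbT.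
  case: i {ti ni} imin => [_|i imin]; first by rewrite mul0r.
  by rewrite leNgt; apply/negP => /ltW/imin; rewrite ltnn.
rewrite (nneseries_split 0 n)//; last by move=> i _; exact: diam_pow_ge0.
rewrite eseries0 ?adde0; last first.
  move=> i; rewrite add0n => ni _; rewrite /diam_pow /B ltnNge ni/=.
  by rewrite ifT// eqxx.
apply: (@le_trans _ _ (\sum_(0 <= i < n) ((c / n%:R) `^ s)%:E)%E).
  rewrite add0n; apply: lee_sum => i _; rewrite /diam_pow; case: ifP => _.
    by rewrite lee_fin powR_ge0.
  rewrite -poweR_EFin gt0_ler_poweR ?in_itv/= ?diam_ge0 ?leey//.
  - by rewrite ltW// (lt_trans _ s1).
  - by rewrite lee_fin divr_ge0// ltW.
rewrite sumEFin lee_fin sumr_const_nat subn0 -[leLHS]mulr_natl.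
exact: ne.
Qed.

End hausdorff.

(** * Lipschitz curves *)

Section lipschitz_curves.
Context (R : realType) (d : nat).

Lemma lipschitz_rectifiable (a b L : R) (f : R -> 'rV[R]_d) :
  (forall t u, `|f t - f u| <= L * `|t - u|) -> rectifiable a b f.
Proof.
move=> fL; apply: (@le_lt_trans _ _ (d%:R * L * (b - a))%:E); last exact: ltry.
apply: ge_ereal_sup => _ [s abs <-]; rewrite lee_fin /polygonal_length.
set x := nth b (a :: s).
apply: (@le_trans _ _ (\sum_(0 <= i < size s) d%:R * L * (x i.+1 - x i))).
  apply: ler_sum_nat => i /andP[_ si].
  rewrite (le_trans (eucl_le_norm _))// -mulrA ler_wpM2l// (le_trans (fL _ _))//.
  rewrite ger0_norm// subr_ge0 ltW//.
  by case: abs => /(pathP b) /(_ _ si).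
rewrite -mulr_sumr telescope_sumr// /x.
by rewrite (itv_partition_nth_size b abs).
Qed.

Lemma lipschitz_curve (a b L : R) (f : R -> 'rV[R]_d) : a < b ->
  (forall t u, `|f t - f u| <= L * `|t - u|) -> curve a b f.
Proof.
move=> ab fL; split=> //; apply: continuous_subspaceT => t.
apply/cvgrPdist_le => e e0.
have M0 : 0 < `|L| + 1 by rewrite ltr_wpDl.
near=> u; rewrite (le_trans (fL _ _))//.
rewrite (@le_trans _ _ ((`|L| + 1) * `|t - u|))//.
  by rewrite ler_wpM2r// (le_trans (ler_norm _))// lerDl.
rewrite -ler_pdivlMl// mulrC.
near: u; apply: cvgr_dist_le => //.
by rewrite divr_gt0.
Unshelve. all: end_near. Qed.

(** McShane's extension, one coordinate at a time: the infimum of the cones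
    [t |-> x u + L * |t - T u|] is the largest [L]-Lipschitz function lying below
    the data. Working coordinatewise loses nothing in the sup norm. *)
Lemma lipschitz_extension (U : set R) (T : R -> R) (x : R -> 'rV[R]_d) (L : R) :
  U !=set0 -> 0 <= L ->
  (forall u v, U u -> U v -> `|x u - x v| <= L * `|T u - T v|) ->
  exists f : R -> 'rV[R]_d,
    (forall t t', `|f t - f t'| <= L * `|t - t'|) /\
    (forall u, U u -> f (T u) = x u).
Proof.
move=> [u0 U0] L0 xL.
have xLi i u v t : U u -> U v ->
    x u 0 i <= x v 0 i + L * `|t - T v| + L * `|t - T u|.
  move=> Uu Uv.
  have := le_trans (coord_le_norm _ i) (xL _ _ Uu Uv); rewrite !mxE => /ler_normlW.
  have : L * `|T u - T v| <= L * `|t - T u| + L * `|t - T v|.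
    by rewrite -mulrDr ler_wpM2l// [`|t - T u|]distrC ler_distD.
  by lra.
pose S i t := [set x u 0 i + L * `|t - T u| | u in U].
have S_inf i t : has_inf (S i t).
  split; first by exists (x u0 0 i + L * `|t - T u0|); exists u0.
  exists (x u0 0 i - L * `|t - T u0|) => _ [u Uu <-].
  by have := xLi i _ _ t U0 Uu; lra.
exists (fun t => \row_i inf (S i t)); split; last first.
  move=> u Uu; apply/rowP => i; rewrite mxE; apply/eqP; rewrite eq_le; apply/andP; split.
    apply: ge_inf; first by case: (S_inf i (T u)).
    by exists u => //; rewrite subrr normr0 mulr0 addr0.
  apply: lb_le_inf; first by case: (S_inf i (T u)).
  move=> _ [v Uv <-]; have := xLi i _ _ (T u) Uu Uv.
  by rewrite subrr normr0 mulr0 addr0.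
(* By symmetry it suffices to bound the difference from one side. *)
have half i t t' : inf (S i t) - inf (S i t') <= L * `|t - t'|.
  rewrite lerBlDr -lerBlDl; apply: lb_le_inf; first by case: (S_inf i t').
  move=> _ [v Uv <-].
  have : inf (S i t) <= x v 0 i + L * `|t - T v|.
    by apply: ge_inf; [case: (S_inf i t)|exists v].
  have : L * `|t - T v| <= L * `|t - t'| + L * `|t' - T v|.
    by rewrite -mulrDr ler_wpM2l// ler_distD.
  by lra.
move=> t t'; apply: norm_le_coord => [|i]; first by rewrite mulr_ge0.
rewrite !mxE ler_norml half andbT lerNl opprB.
by rewrite distrC half.
Qed.

End lipschitz_curves.

(** * Cells and scales *)

Section scales.
Context (R : realType) (D : R).

(** The product of [nchildren j] over [j < k]. A square in the exponent makes
    [ncells] superexponential, which brings the dimension up to 1, with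
    consecutive ratios growing only like [4 ^ k], which keeps the length of the
    curve finite. *)
Definition ncells (k : nat) : nat := 2 ^ (k ^ 2).

Definition nchildren (k : nat) : nat := 2 ^ (2 * k).+1.

(** The factor [8 ^ k] beats the [4 ^ k] by which consecutive numbers of cells
    differ. *)
Definition radius (k : nat) : R := D / (8 ^ k * ncells k)%:R.

Lemma ncells_gt0 k : (0 < ncells k)%N.
Proof. by rewrite expn_gt0. Qed.

Lemma nchildren_gt0 k : (0 < nchildren k)%N.
Proof. by rewrite expn_gt0. Qed.

Lemma ncellsS k : ncells k.+1 = (ncells k * nchildren k)%N.
Proof. by rewrite /ncells /nchildren -expnD; congr (2 ^ _)%N; lia. Qed.

Lemma ltn_ncells k : (k < ncells k)%N.
Proof.
apply: (@leq_trans (2 ^ k)); first exact: ltn_expl.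
by rewrite leq_exp2l//; case: k => // k; rewrite leq_pmulr.
Qed.

Lemma radius_gt0 k : 0 < D -> 0 < radius k.
Proof. by move=> D0; rewrite divr_gt0// ltr0n muln_gt0 expn_gt0 ncells_gt0. Qed.

(** Room for all the children of a node: spaced by [3 * radius k.+1], they stay
    within [radius k / 2] of it, as [3 <= 8 / 2]. *)
Lemma radiusS k : radius k = 8 * (nchildren k)%:R * radius k.+1.
Proof.
rewrite /radius ncellsS expnS -mulnA.
rewrite (_ : (8 * (8 ^ k * (ncells k * nchildren k)) =
  8 * nchildren k * (8 ^ k * ncells k))%N); last by lia.
rewrite -natrM [in RHS](natrM _ (8 * _)%N) invfM [in RHS]mulrCA mulVKf//.
by rewrite pnatr_eq0 -lt0n muln_gt0 nchildren_gt0.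
Qed.

Lemma radiusS_le k : 0 < D -> 8 * radius k.+1 <= radius k.
Proof.
move=> D0; rewrite [leRHS]radiusS ler_wpM2r ?(ltW (radius_gt0 _ D0))// ler_peMr//.
by rewrite ler1n nchildren_gt0.
Qed.

Lemma truncn_mul_divn (x : R) (m : nat) : 0 <= x -> (0 < m)%N ->
  (Num.truncn (x * m%:R) %/ m)%N = Num.truncn x.
Proof.
move=> x0 m0; have m0' : 0 < m%:R :> R by rewrite ltr0n.
have /andP[h1 h2] := truncn_itv (mulr_ge0 x0 (ltW m0')).
apply/esym/truncn_def; apply/andP; split.
  rewrite -(ler_pM2r m0') -natrM (le_trans _ h1)// ler_nat.
  exact: leq_trunc_div.
rewrite -(ltr_pM2r m0') (lt_le_trans h2)// -natrM ler_nat.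
by rewrite -ltn_divLR.
Qed.

Definition cell (k : nat) (u : R) : nat := Num.truncn (u * (ncells k)%:R).

(** The subdivisions into cells refine each other, the parent of the cell [c]
    being [c %/ nchildren k]. *)
Lemma cellS k u : 0 <= u -> (cell k.+1 u %/ nchildren k)%N = cell k u.
Proof.
move=> u0; rewrite /cell ncellsS natrM mulrA truncn_mul_divn ?nchildren_gt0//.
by rewrite mulr_ge0.
Qed.

Lemma le_cell k u v : u <= v -> (cell k u <= cell k v)%N.
Proof. by move=> uv; rewrite le_truncn// ler_wpM2r. Qed.

Lemma cell_eq_dist k u v : 0 <= u -> 0 <= v -> cell k u = cell k v ->
  `|u - v| <= (ncells k)%:R^-1.
Proof.
move=> u0 v0 uv; have P0 : 0 < (ncells k)%:R :> R by rewrite ltr0n ncells_gt0.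
rewrite -(ler_pM2r P0) mulVf ?gt_eqF// -[X in _ * X]ger0_norm ?(ltW P0)//.
rewrite -normrM mulrBl.
have := truncn_itv (mulr_ge0 u0 (ltW P0)); rewrite -/(cell k u) uv.
have := truncn_itv (mulr_ge0 v0 (ltW P0)); rewrite -/(cell k v) -natr1.
by rewrite ler_distl => /andP[? ?] /andP[? ?]; apply/andP; split; lra.
Qed.

(** Distinct parameters share the only cell of level 0 and end up in different
    cells: some level is the first to separate them. *)
Lemma cell_split u v : 0 <= u -> u < v -> v < 1 ->
  exists k, cell k u = cell k v /\ (cell k.+1 u < cell k.+1 v)%N.
Proof.
move=> u0 uv v1; have v0 : 0 <= v by rewrite ltW// (le_lt_trans u0).
have ex : exists k, (cell k u < cell k v)%N.
  pose k := Num.truncn (v - u)^-1; exists k.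
  have P0 : 0 < (ncells k)%:R :> R by rewrite ltr0n ncells_gt0.
  rewrite truncn_lt_nat ?mulr_ge0 ?(ltW P0)//.
  have Pk : (v - u)^-1 < (ncells k)%:R.
    by rewrite (lt_le_trans (truncnS_gt _))// ler_nat ltn_ncells.
  have {}Pk : 1 < v * (ncells k)%:R - u * (ncells k)%:R.
    by rewrite -mulrBl mulrC -ltr_pdivrMr ?subr_gt0// mul1r.
  have /andP[_] := truncn_itv (mulr_ge0 v0 (ltW P0)).
  by rewrite -natr1 -/(cell k v); lra.
have [[|k] ck kmin] := ex_minnP ex.
  have : (cell 0 v < 1)%N by rewrite /cell /ncells mulr1 truncn_lt_nat.
  by move: ck; case: (cell 0 v).
exists k; split=> //; apply/eqP; rewrite eqn_leq le_cell ?ltW//=.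
by rewrite leqNgt; apply/negP => /kmin; rewrite ltnn.
Qed.

End scales.

(** * A tree of points in a continuum *)

Section tree.
Context (R : realType) (V : normedModType R) (K : set V).
Hypotheses (cK : compact K) (kK : connected K).

(** The hypothesis nests the closed balls of centre [y k] and radius [r k], so
    that they contain every cluster point of [y]. *)
Lemma compact_nested_limit (r : nat -> R) (y : nat -> V) :
  (forall k, 0 <= r k) -> (forall k, K (y k)) ->
  (forall k, `|y k.+1 - y k| <= r k - r k.+1) ->
  exists x, K x /\ forall k, `|x - y k| <= r k.
Proof.
move=> r0 Ky yr.
have dist k j : `|y (j + k)%N - y k| <= r k - r (j + k)%N.
  elim: j => [|j IH]; first by rewrite !add0n !subrr normr0.
  rewrite -(subrKA (y (j + k)%N)) (le_trans (ler_normD _ _))//.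
  by rewrite (le_trans (lerD (yr _) IH))// addSn; lra.
have [x [Kx clx]] : K `&` cluster (y @ \oo) !=set0.
  by apply: cK; exists 0%N => // n _; exact: Ky.
exists x; split=> // k; apply/ler_addgt0Pr => e e0.
have [|v [/= vk xv]] := clx [set v | `|v - y k| <= r k] (ball x e) _ (nbhsx_ballx _ _ e0).
  exists k => // n /= kn; rewrite -(subnK kn).
  by rewrite (le_trans (dist _ _))// gerBl.
rewrite -(subrKA v) (le_trans (ler_normD _ _))// addrC lerD//.
by rewrite ltW//; move: xv; rewrite -ball_normE.
Qed.

(** One of [p], [q] is at distance at least [|p - q| / 2] from [z], and the
    distances to [z] of the points of [K] form an interval. *)
Lemma connected_meets_sphere (p q z : V) (t : R) :
  K p -> K q -> K z -> 0 <= t <= `|p - q| / 2 -> exists y, K y /\ `|y - z| = t.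
Proof.
move=> Kp Kq Kz /andP[t0 t1].
have cf : {within K, continuous (fun y => `|y - z|)}.
  apply: continuous_subspaceT => y.
  by apply: cvg_norm; apply: cvgB; [exact: cvg_id|exact: cvg_cst].
have := connected_continuous_connected kK cf.
move=> /connected_intervalP itv.
have [w Kw tw] : exists2 w, K w & t <= `|w - z|.
  have := ler_distD z p q; rewrite [`|z - q|]distrC => pq.
  have [tp|tp] := leP t `|p - z|; first by exists p.
  by exists q => //; lra.
have [//|||y Ky yt] := itv 0 `|w - z| _ _ t; last by exists y.
- by exists z => //; rewrite subrr normr0.
- by exists w.
- by rewrite t0 tw.
Qed.

Section build.
Variables p q : V.
Hypotheses (Kp : K p) (Kq : K q) (pq : p != q).
Let D := `|p - q|.
Let r := radius D.

Let D0 : 0 < D. Proof. by rewrite normr_gt0 subr_eq0. Qed.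

(** The [i]-th child of a node is chosen on the sphere of radius
    [3 * radius k.+1 * i] around it: siblings lie on distinct concentric
    spheres, and this alone separates them. The index [c] ranges over all
    natural numbers, with every [z 0 c] the same point. *)
Lemma connected_tree : exists z : nat -> nat -> V,
  [/\ forall k c, K (z k c),
      forall k c, `|z k.+1 c - z k (c %/ nchildren k)%N| <= r k / 2 &
      forall k c c', c != c' -> (c %/ nchildren k = c' %/ nchildren k)%N ->
        3 * r k.+1 <= `|z k.+1 c - z k.+1 c'| ].
Proof.
have /choice[g gP] : forall zt : V * R, exists y, K zt.1 -> 0 <= zt.2 <= D / 2 ->
    K y /\ `|y - zt.1| = zt.2.
  move=> [z t]; have [Kz|Kz] := pselect (K z); last by exists z.
  have [tD|/negP tD] := boolP (0 <= t <= D / 2); last by exists z.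
  by have [y yP] := connected_meets_sphere Kp Kq Kz tD; exists y.
pose t k c : R := 3 * r k.+1 * (c %% nchildren k)%:R.
pose z := fix z k c := if k is k'.+1 then g (z k' (c %/ nchildren k')%N, t k' c) else p.
have t_itv k c : 0 <= t k c <= r k / 2.
  apply/andP; split; first by rewrite mulr_ge0// mulr_ge0// ltW// radius_gt0.
  have : (c %% nchildren k)%:R <= (nchildren k)%:R :> R.
    by rewrite ler_nat ltnW// ltn_mod nchildren_gt0.
  move/(ler_wpM2l (ltW (radius_gt0 k.+1 D0))).
  have : 0 <= radius D k.+1 * (nchildren k)%:R by rewrite mulr_ge0// ltW// radius_gt0.
  rewrite /t /r (radiusS D k); lra.
have rD k : r k <= D.
  elim: k => [|k IH]; first by rewrite /r /radius !expn0 muln1 divr1.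
  by rewrite (le_trans _ IH)//; have := radiusS_le k D0; have := radius_gt0 k.+1 D0; rewrite -/r; lra.
have t_itv' k c : 0 <= t k c <= D / 2.
  by have := t_itv k c; have := rD k; lra.
have zK k c : K (z k c).
  elim: k c => [//|k IH] c /=.
  by have [] := gP (z k (c %/ nchildren k)%N, t k c) (IH _) (t_itv' _ _).
have zd k c : `|z k.+1 c - z k (c %/ nchildren k)%N| = t k c.
  by have [] := gP (z k (c %/ nchildren k)%N, t k c) (zK _ _) (t_itv' _ _).
exists z; split=> //.
  by move=> k c; rewrite zd; case/andP: (t_itv k c).
move=> k c c' cc' par.
have sep : 3 * r k.+1 <= `|t k c - t k c'|.
  have a0 : 0 <= 3 * r k.+1 by rewrite mulr_ge0// ltW// radius_gt0.
  rewrite -mulrBr normrM (ger0_norm a0) ler_peMr//.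
  have : (c %% nchildren k != c' %% nchildren k)%N.
    apply: contra cc' => /eqP mods; apply/eqP.
    by rewrite (divn_eq c (nchildren k)) (divn_eq c' (nchildren k)) par mods.
  rewrite neq_ltn => /orP[]; rewrite -(ler_nat R) -natr1 => h.
    by rewrite distrC ler_normr; apply/orP; left; lra.
  by rewrite ler_normr; apply/orP; left; lra.
apply: (le_trans sep); rewrite -(zd k c) -(zd k c') -par.
by rewrite (le_trans (ler_dist_dist _ _))// opprB addrA subrK.
Qed.

(** Replacing the nodes by the limits of branches moves each of them by at most
    [r k.+1], which leaves a third of the separation [3 * r k.+1] of siblings. *)
Lemma tree_points : exists x : R -> V,
  [/\ forall u, 0 <= u -> K (x u),
      forall k u v, 0 <= u -> 0 <= v -> cell k u = cell k v ->
        `|x u - x v| <= 2 * r k &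
      forall k u v, 0 <= u -> 0 <= v -> cell k u = cell k v ->
        cell k.+1 u != cell k.+1 v -> r k.+1 <= `|x u - x v|].
Proof.
have [z [zK zd zsep]] := connected_tree.
have /choice[x xP] : forall u : R, exists x, 0 <= u ->
    K x /\ forall k, `|x - z k (cell k u)| <= r k.
  move=> u; have [u0|u0] := leP 0 u; last by exists p.
  have [] := @compact_nested_limit r (fun k => z k (cell k u)).
  - by move=> k; exact/ltW/radius_gt0.
  - by move=> k; exact: zK.
  - move=> k; rewrite -(cellS k u0) (le_trans (zd _ _))//.
    by have := radiusS_le k D0; have := radius_gt0 k.+1 D0; rewrite -/r; lra.
  by move=> x xP; exists x.
exists x; split.
- by move=> u /xP[].
- move=> k u v /xP[_ /(_ k) xu] /xP[_ /(_ k) xv] uv.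
  rewrite -(subrKA (z k (cell k u))) (le_trans (ler_normD _ _))//.
  by rewrite uv [X in _ + X]distrC -uv; rewrite uv in xu *; lra.
- move=> k u v u0 v0 uv uv1.
  have [_ /(_ k.+1) xu] := xP _ u0; have [_ /(_ k.+1) xv] := xP _ v0.
  have := zsep k _ _ uv1; rewrite !cellS// => /(_ uv).
  have := ler_distD (x u) (z k.+1 (cell k.+1 u)) (z k.+1 (cell k.+1 v)).
  have := ler_distD (x v) (x u) (z k.+1 (cell k.+1 v)).
  by rewrite [`|z _ _ - x u|]distrC; lra.
Qed.

End build.
End tree.

(** * A time scale for the curve *)

Section clock.
Context (R : realType) (D : R).
Hypothesis D0 : 0 < D.

Let ticks (u : R) (n : nat) : R := \sum_(k < n) (cell k.+1 u)%:R * radius D k.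

(** The sum of the series of [cell k.+1 u * radius D k], written as a supremum
    because all terms are nonnegative. Each term is nondecreasing in [u], so no
    cancellation occurs between levels. *)
Definition clock (u : R) : R := sup (range (ticks u)).

(** The term of index [n] is at most [ncells n.+1 * radius D n = 2 * D / 2 ^ n]. *)
Lemma ticks_le u n : u < 1 -> ticks u n <= 4 * D.
Proof.
move=> u1; suff : ticks u n <= 4 * D - 4 * D / 2 ^+ n.
  have : 0 <= 4 * D / 2 ^+ n by rewrite divr_ge0 ?exprn_ge0// mulr_ge0// ltW.
  by lra.
elim: n => [|n IH]; first by rewrite /ticks big_ord0 expr0 divr1 subrr.
rewrite /ticks big_ord_recr/= (le_trans (lerD IH (lexx _)))//.
have : (cell n.+1 u)%:R * radius D n <= 2 * D / 2 ^+ n.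
  rewrite /radius mulrA ler_pdivrMr; last by rewrite ltr0n muln_gt0 expn_gt0 ncells_gt0.
  have cn : (cell n.+1 u)%:R <= (ncells n.+1)%:R :> R.
    by rewrite ler_nat (leq_trans (le_cell _ (ltW u1)))// /cell mul1r natrK.
  have -> : 2 * D / 2 ^+ n * (8 ^ n * ncells n)%:R = (ncells n.+1)%:R * D.
    rewrite ncellsS /nchildren expnS expnM -[8%N]/(2 * 4)%N expnMn !natrM natrX.
    by field; rewrite expf_neq0.
  by rewrite ler_wpM2r// ltW.
have -> : 4 * D / 2 ^+ n = 2 * (2 * D / 2 ^+ n) by rewrite !mulrA -natrM.
have -> : 4 * D / 2 ^+ n.+1 = 2 * D / 2 ^+ n.
  by rewrite exprS; field; rewrite expf_neq0.
by lra.
Qed.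

Lemma ticks_ge0 u n : 0 <= ticks u n.
Proof. by apply: sumr_ge0 => k _; rewrite mulr_ge0// ltW// radius_gt0. Qed.

Lemma has_sup_ticks u : u < 1 -> has_sup (range (ticks u)).
Proof.
move=> u1; split; first by exists (ticks u 0); exists 0%N.
by exists (4 * D) => _ [n _ <-]; exact: ticks_le.
Qed.

Lemma clock_itv u : u < 1 -> 0 <= clock u <= 4 * D.
Proof.
move=> u1; have [ne ub] := has_sup_ticks u1; apply/andP; split.
  by apply: (@le_trans _ _ (ticks u 0)); rewrite ?ticks_ge0//; apply: ub_le_sup => //; exists 0%N.
by apply: ge_sup => // _ [n _ <-]; exact: ticks_le.
Qed.

(** The cells of level [k.+1] differ by at least one unit, worth [radius D k],
    and the other terms can only add to the difference. *)
Lemma clock_gap k u v : u <= v -> v < 1 -> (cell k.+1 u < cell k.+1 v)%N ->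
  radius D k <= clock v - clock u.
Proof.
move=> uv v1 ck; rewrite lerBrDr -lerBrDl.
apply: ge_sup; first by have [] := has_sup_ticks (le_lt_trans uv v1).
move=> _ [n _ <-]; rewrite lerBrDl.
have term j : (cell j.+1 u)%:R * radius D j <= (cell j.+1 v)%:R * radius D j.
  by rewrite ler_wpM2r ?(ltW (radius_gt0 _ D0))// ler_nat le_cell.
(* Enough terms are taken for the one of index [k] to be among them. *)
apply: (@le_trans _ _ (radius D k + ticks u (n + k.+1))).
  rewrite lerD2l /ticks big_split_ord/= lerDl; apply: sumr_ge0 => i _.
  by rewrite mulr_ge0// ltW// radius_gt0.
apply: (@le_trans _ _ (ticks v (n + k.+1))); last first.
  by apply: ub_le_sup; [case: (has_sup_ticks v1)|exists (n + k.+1)%N].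
have kn : (k < n + k.+1)%N by rewrite addnS ltnS leq_addl.
rewrite /ticks (bigD1 (Ordinal kn))//= [leRHS](bigD1 (Ordinal kn))//= addrA lerD//.
  rewrite -[X in X + _]mul1r -mulrDl ler_wpM2r ?(ltW (radius_gt0 _ D0))//.
  by rewrite addrC natr1 ler_nat.
exact: ler_sum.
Qed.

End clock.

(** * Dimension one *)

(** With [radius D k.+1 = D * 2 ^ (- (k ^ 2 + 5 k + 4))], taking binary
    logarithms leaves [s (k ^ 2 + 5 k + 4) <= k ^ 2 + q]: as [s < 1], the
    leading term on the right wins. *)
Lemma radius_hoelder (R : realType) (D s : R) : 0 < D -> 0 < s -> s < 1 ->
  exists2 C : R, 0 < C &
    forall k, (ncells k)%:R^-1 <= C * radius D k.+1 `^ s.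
Proof.
move=> D0 s0 s1; have e0 : 0 < 1 - s by rewrite subr_gt0.
(* [25 / (4 (1 - s))] is the maximum of [5 k - (1 - s) k ^ 2]. *)
pose q := 4 + 25 / (4 * (1 - s)).
exists (2 `^ q * (D `^ s)^-1); first by rewrite mulr_gt0 ?invr_gt0 ?powR_gt0.
move=> k.
have -> : radius D k.+1 = D * 2 `^ (- (k%:R ^+ 2 + 5 * k%:R + 4)).
  rewrite /radius /ncells -[8%N]/(2 ^ 3)%N -expnM -expnD.
  rewrite (_ : (3 * k.+1 + k.+1 ^ 2 = k ^ 2 + 5 * k + 4)%N); last by lia.
  rewrite powRN; congr (_ / _).
  by rewrite -natrX -natrM -!natrD powR_mulrn// natrX.
rewrite powRM ?powR_ge0 ?(ltW D0)//.
rewrite mulrA -[_ * _ * D `^ s]mulrA mulVf ?gt_eqF ?powR_gt0// mulr1.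
rewrite -powRrM -powRD; last by rewrite pnatr_eq0 implybT.
have -> : (ncells k)%:R^-1 = 2 `^ (- k%:R ^+ 2) :> R.
  by rewrite powRN -natrX powR_mulrn// /ncells natrX.
apply: ler_powR; first by rewrite ler1n.
have k0 : 0 <= k%:R :> R by [].
have : 0 <= (1 - s) * (k%:R - 5 / (2 * (1 - s))) ^+ 2 by rewrite mulr_ge0 ?sqr_ge0 ?ltW.
have -> : (1 - s) * (k%:R - 5 / (2 * (1 - s))) ^+ 2 =
  (1 - s) * k%:R ^+ 2 - 5 * k%:R + 25 / (4 * (1 - s)).
  by field; rewrite gt_eqF.
rewrite /q; set w := 25 / _ => h.
have : s * (5 * k%:R + 4) <= 5 * k%:R + 4 by rewrite ler_piMl ?ltW// addr_gt0// mulr_ge0.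
by move: h; lra.
Qed.

Theorem theorem3p4 (R : realType) (d : nat) (K : set 'rV[R]_d) :
  continuum K -> non_degenerate K ->
  exists (a b : R) (f : R -> 'rV[R]_d),
    [/\ curve a b f, rectifiable a b f &
        hausdorff_dim ((f @` `[a, b]) `&` K) = 1%E].
Proof.
move=> [cK kK] [p [q [Kp Kq /eqP pq]]].
set D := `|p - q|.
have D0 : 0 < D by rewrite normr_gt0 subr_eq0.
have [x [xK xclose xfar]] := tree_points cK kK Kp Kq pq.
rewrite -/D in xclose xfar.
pose T : R -> R := clock D.
have Uitv (u : R) : `[0, 1[%classic u -> 0 <= u < 1 by rewrite /= in_itv.
have xT (u v : R) : `[0, 1[%classic u -> `[0, 1[%classic v ->
    `|x u - x v| <= 2 * `|T u - T v|.
  move=> /Uitv + /Uitv; wlog uv : u v / u < v.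
    move=> H u01 v01; case: (ltgtP u v) => [uv|uv|->]; first exact: H.
      by rewrite distrC [`|T u - _|]distrC; exact: H.
    by rewrite !subrr !normr0 mulr0.
  move=> /andP[u0 u1] /andP[v0 v1].
  have [k [ck ck1]] := cell_split u0 uv v1.
  rewrite (le_trans (xclose k _ _ u0 v0 ck))// ler_wpM2l// distrC.
  by rewrite (le_trans (clock_gap D0 (ltW uv) v1 ck1))// ler_norm.
have U0 : (`[0, 1[%classic : set R) !=set0.
  by exists 0; rewrite /= in_itv/= lexx ltr01.
have [f [fL fx]] := lipschitz_extension U0 (ler0n _ 2) xT.
exists 0, (4 * D), f; split.
- by apply: (lipschitz_curve _ fL); rewrite mulr_gt0.
- exact: lipschitz_rectifiable fL.
apply/eqP; rewrite eq_le; apply/andP; split.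
  apply: ge_ereal_sup => _ [s [s0 Hs] <-]; rewrite lee_fin leNgt; apply/negP => s1.
  have b0 : 0 <= 4 * D by rewrite mulr_ge0// ltW.
  by move: Hs; rewrite (hausdorff_measure_lipschitz s1 b0 (ler0n _ 2) fL (@subIsetl _ _ K)) ltxx.
have dimge (s : R) : 0 < s -> s < 1 ->
    (s%:E <= hausdorff_dim ((f @` `[0%R, (4 * D)%R]) `&` K))%E.
  move=> s0 s1; apply: ereal_sup_ubound; exists s => //; split; first exact: ltW.
  have [C C0 HC] := radius_hoelder D0 s0 s1.
  apply: (@hausdorff_measure_gt0 _ _ s C x) => //.
    move=> _ [u /Uitv u01 <-]; have /andP[u0 u1] := u01; split; last exact: xK.
    by exists (T u); [rewrite /= in_itv/=; exact: clock_itv|apply: fx; rewrite /= in_itv].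
  move=> u v; rewrite !in_itv/=; wlog uv : u v / u < v.
    move=> H u01 v01; case: (ltgtP u v) => [uv|uv|->]; first exact: H.
      by rewrite distrC [`|x u - _|]distrC; exact: H.
    by rewrite !subrr !normr0 mulr_ge0 ?powR_ge0 ?(ltW C0).
  move=> /andP[u0 u1] /andP[v0 v1].
  have [k [ck ck1]] := cell_split u0 uv v1.
  rewrite (le_trans (cell_eq_dist u0 v0 ck))// (le_trans (HC k))//.
  rewrite ler_wpM2l ?(ltW C0)// ge0_ler_powR ?(ltW s0) ?nnegrE//.
    by rewrite ltW// radius_gt0.
  by apply: xfar => //; rewrite neq_ltn ck1.
apply/lee_subgt0Pr => e e0.
have [e1|e1] := ltP e 1.
  by apply: dimge; lra.
apply: (le_trans _ (dimge 2^-1 _ _)); rewrite ?lee_fin; lra.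
Qed.
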